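(* Let $G:\mathbb{R}^n\to\mathbb{R}^n$ be Lipschitz continuous with constant $c<1$ (with $c\ge 0$), i.e. $\|G(\mathbf{u})-G(\mathbf{v})\|\le c\|\mathbf{u}-\mathbf{v}\|$ for all $\mathbf{u},\mathbf{v}\in\mathbb{R}^n$, and let $\mathbf{u}^*$ be its fixed point. Let $m\ge 1$ be an integer, $\lambda\in(0,1]$, $\mathbf{u}_0\in\mathbb{R}^n$, and suppose that the parameters $\{\gamma_k\}_{k\ge 0}$ used in the algorithm GlobAA($m$) satisfy: (i) $\gamma_k\in(0,1)$ for all $k\ge 0$; (ii) $\{\gamma_k\}$ is non-decreasing and $\gamma_k\to 1$ as $k\to\infty$; (iii) $\sum_{k=0}^\infty(1-\gamma_k)=\infty$. Let $\{\mathbf{u}_k\}$ be the (infinite) sequence generated by GlobAA($m$). Then $\|F(\mathbf{u}_k)\|\to 0$ and $\mathbf{u}_k\to\mathbf{u}^*$ as $k\to\infty$. Moreover, suppose in addition that $G$ is differentiable at $\mathbf{u}^*$ and that the coefficients $\{\alpha_j^k\}_{j=0}^{m_k}$ of the algorithm satisfy, for all $k\ge 1$: (a) $\big\|\sum_{j=0}^{m_k}\alpha_j^kF_{k-m_k+j}\big\|\le\|F_k\|$; (b) $\sum_{j=0}^{m_k}\alpha_j^k=1$; (c) $\sum_{j=0}^{m_k}|\alpha_j^k|\le M_\alpha$ for some constant $M_\alpha\ge 1$ independent of $k$. Then there exists $K_0\in\mathbb{N}$ such that for every $k\ge K_0$ the acceptance condition $$\|F(\mathbf{u}_{\rm AA}^{k+1})\|\le\gamma_k\max_{0\le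 j\le m_k}\|F_{k-m_k+j}\|$$ is satisfied; consequently $\mathbf{u}_{k+1}=\mathbf{u}_{\rm AA}^{k+1}$ for every $k\ge K_0$, i.e. the iterates of GlobAA($m$) coincide with those generated by pure Anderson acceleration thereafter.
   Context: $\|\cdot\|$ is the Euclidean norm on $\mathbb{R}^n$. For $G:\mathbb{R}^n\to\mathbb{R}^n$ the residual mapping is $F(\mathbf{u}):=G(\mathbf{u})-\mathbf{u}$. Algorithm GlobAA($m$). Inputs: $\mathbf{u}_0\in\mathbb{R}^n$, a positive integer $m$, $\lambda\in(0,1]$, and a rule for choosing $\gamma_k\in(0,1)$. Initialize $k=0$, $\kappa=0$. While $\|F(\mathbf{u}_k)\|>0$, do the following. (1) Set $m_k=\min\{m,k-\kappa\}$, $G_k=G(\mathbf{u}_k)$, $F_k=G_k-\mathbf{u}_k$, and choose $\gamma_k$. (2) Let $(\alpha_0^k,\dots,\alpha_{m_k}^k)$ be a solution of $\min\big\|\sum_{j=0}^{m_k}\alpha_jF_{k-m_k+j}\big\|$ subject to $\sum_{j=0}^{m_k}\alpha_j=1$, and set $\mathbf{u}_{\rm AA}^{k+1}=\sum_{j=0}^{m_k}\alpha_j^kG_{k-m_k+j}$. (3) If $\|F(\mathbf{u}_{\rm AA}^{k+1})\|\le\gamma_k\max_{0\le j\le m_k}\|F_{k-m_k+j}\|$ (acceptance condition), set $\mathbf{u}_{k+1}=\mathbf{u}_{\rm AA}^{k+1}$ (Anderson step, $\kappa$ unchanged); otherwise set $\mathbf{u}_{k+1}=(1-\lambda)\mathbf{u}_k+\lambda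 G_k$ and reset $\kappa=k+1$ (Krasnosel'skii–Mann step). (4) Replace $k$ by $k+1$. Standing assumption: the algorithm never stops, i.e. $F(\mathbf{u}_k)\ne 0$ for all $k\ge 0$, so that an infinite sequence is generated. *)

(* Defs.v *)
From HB Require Import structures.
From mathcomp Require Export all_boot all_order all_algebra.
From mathcomp Require Export all_classical all_reals all_analysis.
Export Order.TTheory GRing.Theory Num.Theory.
Export numFieldNormedType.Exports.

Set Implicit Arguments.
Unset Strict Implicit.
Unset Printing Implicit Defensive.

Local Open Scope classical_set_scope.
Local Open Scope ring_scope.

(* The library norm on 'rV[R]_n is the sup norm; the Euclidean one is needed
   for the Lipschitz constant, the least-squares problem and the acceptance
   test.  Both induce the same topology and the same notion of
   differentiability, for which the library's notions are used. *)
Definition enorm (R : realType) (n : nat) (x : 'rV[R]_n) : R :=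
  Num.sqrt (\sum_(i < n) x ord0 i ^+ 2).

Definition residual (R : realType) (n : nat) (G : 'rV[R]_n -> 'rV[R]_n)
  (x : 'rV[R]_n) : 'rV[R]_n := G x - x.

Section Algorithm.
Variables (R : realType) (n : nat) (G : 'rV[R]_n -> 'rV[R]_n) (m : nat).
(* [u k] is the k-th iterate, [kappa k] the value of the restart index at the
   beginning of iteration k, and [alpha k j] the coefficient alpha_j^k, only
   meaningful for j <= mk k. *)
Variables (u : nat -> 'rV[R]_n) (kappa : nat -> nat) (alpha : nat -> nat -> R).

Definition mk (k : nat) : nat := minn m (k - kappa k).

Definition mixed_residual (k : nat) (a : nat -> R) : 'rV[R]_n :=
  \sum_(j < (mk k).+1) a j *: residual G (u (k - mk k + j)%N).

Definition coef_sum (k : nat) (a : nat -> R) : R := \sum_(j < (mk k).+1) a j.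

Definition is_mixing_solution (k : nat) (a : nat -> R) : Prop :=
  coef_sum k a = 1 /\
  forall b : nat -> R, coef_sum k b = 1 ->
    enorm (mixed_residual k a) <= enorm (mixed_residual k b).

(* u_AA^{k+1} *)
Definition uAA (k : nat) : 'rV[R]_n :=
  \sum_(j < (mk k).+1) alpha k j *: G (u (k - mk k + j)%N).

(* Starting the maximum from 0 is harmless as norms are nonnegative. *)
Definition max_residual (k : nat) : R :=
  \big[Num.max/0]_(j < (mk k).+1) enorm (residual G (u (k - mk k + j)%N)).

Definition accepted (gamma : nat -> R) (k : nat) : Prop :=
  enorm (residual G (uAA k)) <= gamma k * max_residual k.

Definition anderson_step (k : nat) : Prop :=
  u k.+1 = uAA k /\ kappa k.+1 = kappa k.

Definition KM_step (lambda : R) (k : nat) : Prop :=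
  u k.+1 = (1 - lambda) *: u k + lambda *: G (u k) /\ kappa k.+1 = k.+1.

(* An infinite run: the stopping test never succeeds. *)
Record GlobAA_run (lambda : R) (gamma : nat -> R) (u0 : 'rV[R]_n) : Prop := {
  run_u0 : u 0%N = u0;
  run_kappa0 : kappa 0%N = 0%N;
  run_nonstop : forall k, 0 < enorm (residual G (u k));
  run_alpha : forall k, is_mixing_solution k (alpha k);
  run_accept : forall k, accepted gamma k -> anderson_step k;
  run_reject : forall k, ~ accepted gamma k -> KM_step lambda k
}.

End Algorithm.

(* Main.v *)
Require Import Defs.
From mathcomp Require Import ring lra zify.

(** The quantity that drives the proof is the worst residual M_k in the window of
    iteration k (max_residual).  Put q = 1 - lambda (1 - c), the factor by which
    a Krasnosel'skii-Mann step shrinks the residual of a c-Lipschitz map.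

    Convergence.  An accepted Anderson step gives ||F_(k+1)|| <= gamma_k M_k and
    a rejected one gives ||F_(k+1)|| <= q ||F_k|| <= q M_k.  Both factors are at
    most rho_k = 1 - (1 - q)(1 - gamma_k) < 1 (residual_step_le).  The window
    never moves backwards, so M is nonincreasing; after m+1 steps it contains
    only new residuals, and as rho is nondecreasing this yields
    M_(k+m+1) <= rho_(k+m) M_k (max_residual_window_le).  If M stayed above
    some e > 0, the decrements M_k - M_(k+m+1) would be at least
    e (1 - q)(1 - gamma_(k+m)), a divergent series, while their partial sums
    telescope to at most (m+1) M_0 (cvg0_of_slow_decay).  So M tends to 0, and
    (1 - c) ||u - ustar|| <= ||F(u)|| carries this over to the iterates.

    Eventual acceptance.  Let ubar be the combination of the iterates of the
    window with the coefficients alpha^k.  Then u_AA - ubar is the mixed residual,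
    of norm at most ||F_k|| <= M_k, and
      F(u_AA) = (G u_AA - G ubar) + (G ubar - sum_j alpha_j G u_j).
    The first term is at most c M_k.  The second vanishes for affine G, so when
    G is differentiable at ustar and the coefficients are bounded it is o(M_k)
    (affine_defect).  Thus ||F(u_AA)|| <= (c + o(1)) M_k, and the acceptance
    test passes as soon as gamma_k is close enough to 1. *)

Set Implicit Arguments.
Unset Strict Implicit.
Unset Printing Implicit Defensive.

Local Open Scope classical_set_scope.
Local Open Scope ring_scope.

(** * The Euclidean norm *)

Section EuclideanNorm.
Variables (R : realType) (n : nat).
Implicit Types x y : 'rV[R]_n.

Lemma enorm_ge0 x : 0 <= enorm x.
Proof. exact: sqrtr_ge0. Qed.

Lemma sqr_enorm x : enorm x ^+ 2 = \sum_(i < n) x ord0 i ^+ 2.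
Proof. by rewrite sqr_sqrtr// sumr_ge0// => i _; rewrite sqr_ge0. Qed.

Lemma abs_coord_le_enorm x i : `|x ord0 i| <= enorm x.
Proof.
rewrite -(@ler_pXn2r _ 2) ?nnegrE ?enorm_ge0// sqr_enorm real_normK ?num_real//.
by rewrite (bigD1 i)//= lerDl sumr_ge0// => j _; rewrite sqr_ge0.
Qed.

Lemma enorm0_eq0 x : enorm x = 0 -> x = 0.
Proof.
move=> x0; apply/rowP => i; rewrite mxE; apply/eqP.
by rewrite -normr_le0 -x0 abs_coord_le_enorm.
Qed.

Lemma enorm0 : enorm (0 : 'rV[R]_n) = 0.
Proof. by rewrite /enorm big1 ?sqrtr0// => i _; rewrite mxE expr0n. Qed.

Lemma enormZ (a : R) x : enorm (a *: x) = `|a| * enorm x.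
Proof.
rewrite /enorm -sqrtr_sqr -sqrtrM ?sqr_ge0// mulr_sumr.
by congr Num.sqrt; apply: eq_bigr => i _; rewrite mxE exprMn.
Qed.

Lemma enormN x : enorm (- x) = enorm x.
Proof. by rewrite -scaleN1r enormZ normrN1 mul1r. Qed.

(** With a = ||x|| and b = ||y||, summing 2 (b x_i)(a y_i) <= (b x_i)^2 + (a y_i)^2
    gives 2ab <x,y> <= 2 (ab)^2, and ab may be cancelled once it is nonzero. *)
Lemma cauchy_schwarz x y :
  \sum_(i < n) x ord0 i * y ord0 i <= enorm x * enorm y.
Proof.
have [/enorm0_eq0 ->|x0] := eqVneq (enorm x) 0.
  by rewrite enorm0 mul0r big1// => i _; rewrite mxE mul0r.
have [/enorm0_eq0 ->|y0] := eqVneq (enorm y) 0.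
  by rewrite enorm0 mulr0 big1// => i _; rewrite mxE mulr0.
set a := enorm x; set b := enorm y.
have ab : 0 < 2 * (a * b) by rewrite !mulr_gt0// lt0r ?x0 ?y0 enorm_ge0.
rewrite -(ler_pM2l ab).
have -> : 2 * (a * b) * (a * b) =
    \sum_(i < n) ((b * x ord0 i) ^+ 2 + (a * y ord0 i) ^+ 2).
  rewrite big_split /=.
  under eq_bigr do rewrite exprMn.
  under [X in _ = _ + X]eq_bigr do rewrite exprMn.
  by rewrite -!mulr_sumr -!sqr_enorm -/a -/b; ring.
rewrite mulr_sumr; apply: ler_sum => i _.
by have := sqr_ge0 (b * x ord0 i - a * y ord0 i); nra.
Qed.

Lemma enorm_triangle x y : enorm (x + y) <= enorm x + enorm y.
Proof.
rewrite -(@ler_pXn2r _ 2) ?nnegrE ?addr_ge0 ?enorm_ge0//.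
have -> : enorm (x + y) ^+ 2 = enorm x ^+ 2 + enorm y ^+ 2
    + 2 * \sum_(i < n) x ord0 i * y ord0 i.
  rewrite !sqr_enorm mulr_sumr -!big_split /=.
  by apply: eq_bigr => i _; rewrite mxE; ring.
by have := cauchy_schwarz x y; rewrite sqrrD; lra.
Qed.

Lemma enormB x y : enorm (x - y) = enorm (y - x).
Proof. by rewrite -enormN opprB. Qed.

Lemma enorm_sum_le (I : finType) (a : I -> R) (v : I -> 'rV[R]_n) (B : R) :
  (forall i, enorm (v i) <= B) ->
  enorm (\sum_i a i *: v i) <= (\sum_i `|a i|) * B.
Proof.
move=> vB; rewrite mulr_suml.
elim/big_ind2: _ => [|x1 x2 y1 y2 h1 h2|i _]; first by rewrite enorm0.
  by rewrite (le_trans (enorm_triangle _ _))// lerD.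
by rewrite enormZ ler_wpM2l.
Qed.

(** The topology of row vectors comes from the sup norm, so convergence and
    differentiability have to be transported through this bound and the next. *)
Lemma norm_le_enorm x : `|x| <= enorm x.
Proof.
rewrite [`|x|]mx_normrE bigmax_le ?enorm_ge0// => -[i j] _ /=.
by rewrite ord1 abs_coord_le_enorm.
Qed.

Lemma enorm_le_norm x : enorm x <= n%:R * `|x|.
Proof.
have coord i : `|x ord0 i| <= `|x|.
  by rewrite [`|x|]mx_normrE (le_bigmax _ (fun ij => `|x ij.1 ij.2|) (ord0, i)).
rewrite -(@ler_pXn2r _ 2) ?nnegrE ?enorm_ge0 ?mulr_ge0// sqr_enorm.
apply: (@le_trans _ _ (\sum_(i < n) `|x| ^+ 2)).
  apply: ler_sum => i _.
  by rewrite -[leLHS]real_normK ?num_real// lerXn2r ?nnegrE.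
rewrite sumr_const card_ord -[leLHS]mulr_natl exprMn ler_wpM2r ?sqr_ge0//.
by rewrite -natrX ler_nat; case: (n) => // k; rewrite leq_pmulr.
Qed.

End EuclideanNorm.

(** The constant of the norm comparison is absorbed by using the precision
    e / (n+1) in the sup norm; n+1 rather than n keeps it meaningful for n = 0. *)
Lemma diff_enorm (R : realType) (n : nat) (G : 'rV[R]_n -> 'rV[R]_n)
    (p : 'rV[R]_n) (e : R) : differentiable G p -> 0 < e ->
  exists2 r : R, 0 < r & forall x, enorm (x - p) < r ->
    enorm (G x - G p - 'd G p (x - p)) <= e * enorm (x - p).
Proof.
move=> dG e0.
have n1 : 0 < n.+1%:R :> R by rewrite ltr0n.
have /eqaddoP/(_ (e / n.+1%:R)) := diff_locally dG.
rewrite divr_gt0// => /(_ isT).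
move=> /nbhs_ballP[r/= r0 H]; exists r => // x xr.
have := H (x - p); rewrite -ball_normE /= sub0r normrN.
move=> /(_ (le_lt_trans (norm_le_enorm _) xr)).
rewrite !fctE /= subrK opprD addrA => {}H.
apply: le_trans (enorm_le_norm _) _.
apply: (@le_trans _ _ (n.+1%:R * (e / n.+1%:R * `|x - p|))).
  by apply: ler_pM => //; rewrite ler_nat.
rewrite mulrA [_ * (e / _)]mulrC divfK ?gt_eqF// ler_pM2l//.
exact: norm_le_enorm.
Qed.

(** * Slowly decaying sequences *)

(** Raising the shift from p to p+1 adds a telescoping sum
    M p - M (N + p) <= M 0. *)
Lemma sum_shift_diff_le (R : realType) (M : nat -> R) (p N : nat) :
  (forall k, 0 <= M k) -> (forall k, M k.+1 <= M k) ->
  \sum_(0 <= k < N) (M k - M (k + p)%N) <= p%:R * M 0%N.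
Proof.
move=> M0 Mdec.
have Mle k : M k <= M 0%N by elim: k => // k; apply: le_trans.
elim: p => [|p IH].
  by rewrite mul0r big1// => k _; rewrite addn0 subrr.
rewrite -natr1 mulrDl mul1r.
have -> : \sum_(0 <= k < N) (M k - M (k + p.+1)%N) =
  \sum_(0 <= k < N) (M k - M (k + p)%N) + (M p - M (N + p)%N).
  rewrite -[M p - _]opprB -[M p]/(M (0 + p)%N).
  rewrite -(telescope_sumr (fun k => M (k + p)%N))// -sumrN -big_split /=.
  by apply: eq_bigr => k _; rewrite addSn addnS; ring.
by have := Mle p; have := M0 (N + p)%N; lra.
Qed.

(** If M stayed above e > 0, the sums of a k * e (shifted by p) would be dominated
    by the decrements of M, whose partial sums are bounded.  Working with sums of
    decrements avoids infinite products of the factors 1 - a k. *)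
Lemma cvg0_of_slow_decay (R : realType) (M a : nat -> R) (p : nat) :
  (forall k, 0 <= M k) -> (forall k, M k.+1 <= M k) ->
  (forall k, 0 <= a k) ->
  (\sum_(0 <= k <oo) (a k)%:E = +oo)%E ->
  (forall k, a (k + p)%N * M k <= M k - M (k + p.+1)%N) ->
  M @ \oo --> (0 : R).
Proof.
move=> M0 Mdec a0 adiv MaM.
have Mhomo k l : (k <= l)%N -> M l <= M k.
  by elim: l => [|l IH]; [rewrite leqn0 => /eqP->|
    rewrite leq_eqVlt ltnS => /predU1P[->//|/IH]; exact: le_trans].
apply/cvgrPdist_lt => e e0.
suff [k Mke] : exists k, M k < e.
  exists k => // l /= kl; rewrite sub0r normrN ger0_norm//.
  exact: le_lt_trans (Mhomo _ _ kl) Mke.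
apply: contrapT => /forallNP noke.
have eM k : e <= M k by rewrite leNgt; apply/negP.
suff [B sumB] : exists B, forall N, \sum_(0 <= k < N) a k <= B.
  suff : (\sum_(0 <= k <oo) (a k)%:E <= B%:E)%E by rewrite adiv.
  apply: lime_le; first by apply: is_cvg_nneseries => k _ _; rewrite lee_fin.
  by apply: nearW => N; rewrite sumEFin lee_fin.
(* The first p terms are not controlled by the decay and are set apart. *)
exists (\sum_(0 <= k < p) a k + p.+1%:R * M 0%N / e) => N.
apply: (@le_trans _ _ (\sum_(0 <= k < p + N) a k)).
  rewrite addnC (big_cat_nat _ (leq_addr p N))//= lerDl.
  by apply: sumr_ge0.
rewrite (big_cat_nat _ (leq_addr N p))//= lerD2l.
rewrite ler_pdivlMr// mulr_suml.
rewrite -{1}[p]add0n big_addn addKn.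
apply: le_trans (sum_shift_diff_le p.+1 N M0 Mdec).
by apply: ler_sum => k _; apply: le_trans (MaM k); rewrite ler_wpM2l.
Qed.

(** * Residuals of a contraction *)

Section Contraction.
Variables (R : realType) (n : nat) (G : 'rV[R]_n -> 'rV[R]_n) (c : R).
Hypothesis G_lip : forall x y, enorm (G x - G y) <= c * enorm (x - y).

Lemma dist_fixpoint_le p x :
  G p = p -> (1 - c) * enorm (x - p) <= enorm (residual G x).
Proof.
move=> Gp; have := G_lip x p; rewrite Gp.
have := enorm_triangle (G x - p) (x - G x); rewrite addrC addrA subrK.
rewrite (enormB x (G x)) /residual; lra.
Qed.

(** With y the relaxed point, y - x = l F(x), so that
    F(y) = (G y - G x) + (1 - l) F(x) has norm at most (c l + 1 - l) ||F(x)||. *)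
Lemma residual_KM_le (l : R) x : 0 <= l -> l <= 1 ->
  enorm (residual G ((1 - l) *: x + l *: G x))
    <= (1 - l * (1 - c)) * enorm (residual G x).
Proof.
move=> l0 l1; set y := _ + _.
have yx : y - x = l *: residual G x.
  by rewrite /y scalerBl scale1r scalerBr -[x - _ + _]addrA [x + _]addrC addrK addrC.
have -> : residual G y = (G y - G x) + (1 - l) *: residual G x.
  by rewrite scalerBl scale1r -yx /residual opprB [_ + (x - y)]addrA subrK addrA subrK.
apply: le_trans (enorm_triangle _ _) _.
have := G_lip y x; rewrite yx !enormZ !ger0_norm ?subr_ge0//; lra.
Qed.

End Contraction.

(** Affine combinations commute with affine maps, so only the remainder
    T x = G x - G p - 'd G p (x - p) contributes, at the points v i and at their
    combination, which lies within K d of p.  The radius r depends on e and K but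
    not on the points, which is what makes the bound uniform along a run. *)
Lemma affine_defect (R : realType) (n : nat) (G : 'rV[R]_n -> 'rV[R]_n)
    (p : 'rV[R]_n) (K e : R) : differentiable G p -> 1 <= K -> 0 < e ->
  exists2 r : R, 0 < r &
    forall (I : finType) (a : I -> R) (v : I -> 'rV[R]_n) (d : R),
      \sum_i a i = 1 -> \sum_i `|a i| <= K ->
      0 <= d -> d < r -> (forall i, enorm (v i - p) <= d) ->
      enorm (G (\sum_i a i *: v i) - \sum_i a i *: G (v i)) <= e * d.
Proof.
move=> dG K1 e0.
have K0 : 0 < K by lra.
have e'0 : 0 < e / (2 * K) by rewrite divr_gt0// mulr_gt0.
have [r r0 Gr] := diff_enorm dG e'0.
exists (r / K) => [|I a v d a1 aK d0 dr vd]; first exact: divr_gt0.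
have Kdr : K * d < r by rewrite mulrC -ltr_pdivlMr.
have dKd : d <= K * d by rewrite ler_peMl.
have centre (w : 'rV[R]_n) (f : I -> 'rV[R]_n) :
    \sum_i a i *: f i - w = \sum_i a i *: (f i - w).
  under [RHS]eq_bigr do rewrite scalerBr.
  by rewrite sumrB -scaler_suml a1 scale1r.
set y := \sum_i a i *: v i.
have yd : enorm (y - p) <= K * d.
  rewrite /y centre; apply: le_trans (enorm_sum_le _ vd) _.
  by rewrite ler_wpM2r.
pose T x := G x - G p - 'd G p (x - p).
have -> : G y - \sum_i a i *: G (v i) = T y - \sum_i a i *: T (v i).
  have -> : \sum_i a i *: T (v i)
      = (\sum_i a i *: G (v i) - G p) - 'd G p (y - p).
    rewrite /T /y (centre (G p)) (centre p) linear_sum -sumrB.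
    by apply: eq_bigr => i _; rewrite scalerBr [in RHS]linearZ.
  by rewrite /T opprB addrA addrNK opprB addrA subrK.
apply: le_trans (enorm_triangle _ _) _; rewrite enormN.
have Ty : enorm (T y) <= e / (2 * K) * (K * d).
  by apply: le_trans (Gr _ (le_lt_trans yd Kdr)) _; rewrite ler_pM2l.
have Tv i : enorm (T (v i)) <= e / (2 * K) * d.
  apply: le_trans (Gr _ _) _; last by rewrite ler_pM2l.
  exact: le_lt_trans (le_trans (vd i) dKd) Kdr.
have TS : enorm (\sum_i a i *: T (v i)) <= K * (e / (2 * K) * d).
  apply: le_trans (enorm_sum_le _ Tv) _; rewrite ler_wpM2r//.
  by rewrite mulr_ge0// ltW.
have -> : e * d = e / (2 * K) * (K * d) + K * (e / (2 * K) * d).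
  by field; rewrite gt_eqF.
exact: lerD.
Qed.

(** * The window of residuals *)

Section Window.
Variables (R : realType) (n : nat) (G : 'rV[R]_n -> 'rV[R]_n) (m : nat).
Variables (u : nat -> 'rV[R]_n) (kappa : nat -> nat) (alpha : nat -> nat -> R).
Local Notation mk := (mk m kappa).
Local Notation max_residual := (max_residual G m u kappa).
Local Notation uAA := (uAA G m u kappa alpha).

Lemma mk_le k : (mk k <= k)%N.
Proof. by rewrite /Defs.mk geq_min leq_subr orbT. Qed.

Lemma max_residual_ge0 k : 0 <= max_residual k.
Proof. exact: bigmax_ge_id. Qed.

Lemma le_max_residual k i : (k - mk k <= i)%N -> (i <= k)%N ->
  enorm (residual G (u i)) <= max_residual k.
Proof.
move=> ki ik; have := mk_le k => mkk.
have ltj : (i - (k - mk k) < (mk k).+1)%N by lia.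
have := le_bigmax 0
  (fun j : 'I_(mk k).+1 => enorm (residual G (u (k - mk k + j)%N)))
  (Ordinal ltj).
by rewrite /= subnKC.
Qed.

Lemma max_residual_le k (B : R) : 0 <= B ->
  (forall i, (k - mk k <= i)%N -> (i <= k)%N ->
    enorm (residual G (u i)) <= B) ->
  max_residual k <= B.
Proof.
move=> B0 uB; apply: bigmax_le => // j _; apply: uB; first exact: leq_addr.
have := mk_le k; have := ltn_ord j; lia.
Qed.

Lemma uAAE k : uAA k =
  \sum_(j < (mk k).+1) alpha k j *: u (k - mk k + j)%N
    + mixed_residual G m u kappa k (alpha k).
Proof.
rewrite /mixed_residual -big_split; apply: eq_bigr => j _ /=.
by rewrite -scalerDr /residual subrKC.
Qed.

End Window.

(** * Decay of the window maximum along a run *)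

Section Run.
Variables (R : realType) (n : nat) (G : 'rV[R]_n -> 'rV[R]_n) (c : R).
Variables (m : nat) (lambda : R) (gamma : nat -> R) (u0 : 'rV[R]_n).
Variables (u : nat -> 'rV[R]_n) (kappa : nat -> nat) (alpha : nat -> nat -> R).
Hypotheses (c_ge0 : 0 <= c) (c_lt1 : c < 1).
Hypothesis G_lip : forall x y, enorm (G x - G y) <= c * enorm (x - y).
Hypotheses (lambda_gt0 : 0 < lambda) (lambda_le1 : lambda <= 1).
Hypothesis gamma_01 : forall k : nat, 0 < gamma k /\ gamma k < 1.
Hypothesis run : GlobAA_run G m u kappa alpha lambda gamma u0.

Local Notation mk := (mk m kappa).
Local Notation max_residual := (max_residual G m u kappa).
Local Notation rate k := (1 - lambda * (1 - c) * (1 - gamma k)).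

(** An Anderson step keeps the restart index and lengthens the window by at most
    one; a restart makes the new window the singleton of the new iterate. *)
Lemma window_start_ndecr k : (k - mk k <= k.+1 - mk k.+1)%N.
Proof.
have [acc|rej] := pselect (accepted G m u kappa alpha gamma k).
  by have [_ kap] := run_accept run acc; rewrite /Defs.mk kap; lia.
have [_ kap] := run_reject run rej.
by rewrite /Defs.mk kap; lia.
Qed.

Lemma gain_bounds : 0 < lambda * (1 - c) /\ lambda * (1 - c) <= 1.
Proof. by move: c_ge0 c_lt1 lambda_gt0 lambda_le1 => *; split; nra. Qed.

Lemma rate_bounds k : gamma k <= rate k /\ 1 - lambda * (1 - c) <= rate k < 1.
Proof.
have [q0 q1] := gain_bounds; have [g0 g1] := gamma_01 k.
by split; first nra; apply/andP; split; nra.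
Qed.

Lemma rate_ge0 k : 0 <= rate k.
Proof. by have [gr _] := rate_bounds k; have [/ltW/le_trans->] := gamma_01 k. Qed.

(** A common bound for both kinds of steps, so that later arguments need not know
    which one was taken: rate k dominates gamma k and 1 - lambda * (1 - c). *)
Lemma residual_step_le k :
  enorm (residual G (u k.+1)) <= rate k * max_residual k.
Proof.
have [gr /andP[qr _]] := rate_bounds k.
have Mge0 := max_residual_ge0 G m u kappa k.
have [q0 q1] := gain_bounds.
have [acc|rej] := pselect (accepted G m u kappa alpha gamma k).
  have [-> _] := run_accept run acc.
  by apply: le_trans acc _; apply: ler_wpM2r.
have [-> _] := run_reject run rej.
apply: le_trans (residual_KM_le G_lip _ (ltW lambda_gt0) lambda_le1) _.
have := @le_max_residual _ _ G m u kappa k k (leq_subr _ _) (leqnn k).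
by move=> uk; apply: ler_pM; rewrite ?enorm_ge0 ?subr_ge0.
Qed.

Lemma max_residual_nincr k : max_residual k.+1 <= max_residual k.
Proof.
have Mge0 := max_residual_ge0 G m u kappa k.
apply: max_residual_le => // i ki; rewrite leq_eqVlt ltnS => /predU1P[->|ik].
  apply: le_trans (residual_step_le k) _.
  by have [_ /andP[_ /ltW r1]] := rate_bounds k; rewrite ler_piMl.
by apply: le_max_residual => //; apply: leq_trans ki; apply: window_start_ndecr.
Qed.

Lemma max_residual_add_nincr k i : max_residual (k + i)%N <= max_residual k.
Proof.
elim: i => [|i IH]; first by rewrite addn0.
by rewrite addnS; apply: le_trans IH; apply: max_residual_nincr.
Qed.

Hypothesis gamma_ndecr : nondecreasing_seq gamma.

(** The window at k + m + 1 starts after k, so each of its residuals was produced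
    by one of the steps k, ..., k + m, whose rate is at most rate (k + m). *)
Lemma max_residual_window_le k :
  max_residual (k + m.+1)%N <= rate (k + m)%N * max_residual k.
Proof.
apply: max_residual_le => [|i ki ik].
  by rewrite mulr_ge0 ?rate_ge0 ?max_residual_ge0.
have mkm : (mk (k + m.+1) <= m)%N by rewrite /Defs.mk geq_minl.
have -> : i = (k + (i - k.+1)).+1 by lia.
set j := (i - k.+1)%N; have jm : (j <= m)%N by rewrite /j; lia.
apply: le_trans (residual_step_le _) _.
apply: ler_pM; rewrite ?rate_ge0 ?max_residual_ge0 ?max_residual_add_nincr//.
have [q0 _] := gain_bounds.
by rewrite lerD2l lerN2 ler_pM2l// lerD2l lerN2 gamma_ndecr// leq_add2l.
Qed.

Hypothesis gamma_div : (\sum_(0 <= k <oo) (1 - gamma k)%:E = +oo)%E.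

Lemma max_residual_cvg0 : max_residual @ \oo --> (0 : R).
Proof.
have [q0 _] := gain_bounds.
have g1 k : 0 <= 1 - gamma k by have [_ ?] := gamma_01 k; lra.
apply: (@cvg0_of_slow_decay _ _
  (fun k => lambda * (1 - c) * (1 - gamma k)) m) => [k|k|k||k].
- exact: max_residual_ge0.
- exact: max_residual_nincr.
- by rewrite mulr_ge0// ltW.
- under eq_eseriesr do rewrite EFinM.
  rewrite nneseriesZl; last by move=> k _; rewrite lee_fin.
  by rewrite gamma_div gt0_muley// lte_fin.
- by have := max_residual_window_le k; lra.
Qed.

(** Splitting F(u_AA) at G ubar: the Lipschitz bound handles the distance from
    ubar to u_AA, which is the mixed residual. *)
Lemma accepted_of_defect k (e : R) : 0 <= e ->
  enorm (mixed_residual G m u kappa k (alpha k)) <= enorm (residual G (u k)) ->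
  enorm (G (\sum_(j < (mk k).+1) alpha k j *: u (k - mk k + j)%N)
         - uAA G m u kappa alpha k) <= e * max_residual k ->
  c + e <= gamma k ->
  accepted G m u kappa alpha gamma k.
Proof.
move=> e0 mix; set ubar := \sum_(j < _) _ => defect ceg.
have Mk := @le_max_residual _ _ G m u kappa k k (leq_subr _ _) (leqnn k).
have Mge0 := max_residual_ge0 G m u kappa k.
rewrite /accepted.
have -> : residual G (uAA G m u kappa alpha k) =
    (G (uAA G m u kappa alpha k) - G ubar) + (G ubar - uAA G m u kappa alpha k).
  by rewrite addrA subrK.
apply: le_trans (enorm_triangle _ _) _.
apply: (@le_trans _ _ ((c + e) * max_residual k)); last by rewrite ler_wpM2r.
rewrite mulrDl lerD//; apply: le_trans (G_lip _ _) _.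
rewrite ler_wpM2l// {1}uAAE -/ubar addrC addKr.
exact: le_trans mix Mk.
Qed.

End Run.

(** * Convergence and eventual acceptance *)

Theorem theorem2p7 (R : realType) (n : nat) (G : 'rV[R]_n -> 'rV[R]_n)
  (c : R) (ustar : 'rV[R]_n) (m : nat) (lambda : R) (u0 : 'rV[R]_n)
  (gamma : nat -> R) (u : nat -> 'rV[R]_n) (kappa : nat -> nat)
  (alpha : nat -> nat -> R)
  (c_ge0 : 0 <= c) (c_lt1 : c < 1)
  (G_lip : forall x y : 'rV[R]_n, enorm (G x - G y) <= c * enorm (x - y))
  (ustar_fix : G ustar = ustar)
  (m_ge1 : (1 <= m)%N)
  (lambda_gt0 : 0 < lambda) (lambda_le1 : lambda <= 1)
  (gamma_01 : forall k : nat, 0 < gamma k /\ gamma k < 1)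
  (gamma_ndecr : nondecreasing_seq gamma)
  (gamma_cvg : gamma @ \oo --> (1 : R))
  (gamma_div : (\sum_(0 <= k <oo) (1 - gamma k)%:E = +oo)%E)
  (run : GlobAA_run G m u kappa alpha lambda gamma u0) :
  (enorm (residual G (u k)) @[k --> \oo] --> (0 : R) /\ u @ \oo --> ustar) /\
  (differentiable G ustar ->
   (forall k : nat, (1 <= k)%N ->
     enorm (mixed_residual G m u kappa k (alpha k))
       <= enorm (residual G (u k))) ->
   (forall k : nat, (1 <= k)%N -> coef_sum m kappa k (alpha k) = 1) ->
   (exists M : R, 1 <= M /\
     forall k : nat, (1 <= k)%N ->
       \sum_(j < (mk m kappa k).+1) `|alpha k j| <= M) ->
   exists K0 : nat, forall k : nat, (K0 <= k)%N ->
     accepted G m u kappa alpha gamma k /\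
     anderson_step G m u kappa alpha k).
Proof.
have M_cvg := max_residual_cvg0 c_ge0 c_lt1 G_lip lambda_gt0 lambda_le1
  gamma_01 run gamma_ndecr gamma_div.
have M_ge0 := max_residual_ge0 G m u kappa.
have c'0 : 0 < 1 - c by rewrite subr_gt0.
have dist_le x : enorm (x - ustar) <= enorm (residual G x) / (1 - c).
  by rewrite ler_pdivlMr// mulrC; apply: dist_fixpoint_le.
have F_le k : enorm (residual G (u k)) <= max_residual G m u kappa k.
  by apply: le_max_residual; rewrite ?leq_subr.
have F_cvg : enorm (residual G (u k)) @[k --> \oo] --> (0 : R).
  apply: (squeeze_cvgr _ (cvg_cst 0) M_cvg).
  by apply: nearW => k; rewrite enorm_ge0 F_le.
split; first split=> //.
  apply/cvgrPdist_le => e e0.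
  have ec0 : 0 < e * (1 - c) by rewrite mulr_gt0.
  move/cvgrPdist_le : F_cvg => /(_ _ ec0); apply: filterS => k.
  rewrite sub0r normrN ger0_norm ?enorm_ge0// => Fk.
  rewrite distrC (le_trans (norm_le_enorm _))// (le_trans (dist_le _))//.
  by rewrite ler_pdivrMr.
move=> dG mix coef1 [K [K1 coefK]].
(* Window points are within max_residual / (1 - c) of ustar, so this precision
   makes the defect at most (1 - c) / 2 times max_residual; the test then
   succeeds once gamma k exceeds c + (1 - c) / 2 = (1 + c) / 2. *)
pose e := (1 - c) ^+ 2 / 2.
have e0 : 0 < e by rewrite divr_gt0 ?exprn_gt0.
have [r r0 defect] := affine_defect dG K1 e0.
have rc0 : 0 < r * (1 - c) by rewrite mulr_gt0.
have [N1 _ MN1] : \forall k \near \oo, max_residual G m u kappa k < r * (1 - c).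
  move/cvgrPdist_lt : M_cvg => /(_ _ rc0); apply: filterS => k.
  by rewrite sub0r normrN ger0_norm.
have [N2 _ gN2] : \forall k \near \oo, (1 + c) / 2 <= gamma k.
  have c20 : 0 < (1 - c) / 2 by rewrite divr_gt0.
  move/cvgrPdist_lt : gamma_cvg => /(_ _ c20); apply: filterS => k.
  by rewrite ltr_distlC; lra.
exists (maxn 1 (maxn N1 N2)) => k; rewrite !geq_max => /and3P[k1 kN1 kN2].
suff acc : accepted G m u kappa alpha gamma k.
  by split=> //; exact: (run_accept run acc).
set Mk := max_residual G m u kappa k.
apply: (@accepted_of_defect _ _ _ c _ _ _ _ _ c_ge0 G_lip _ ((1 - c) / 2)).
- by rewrite ltW// divr_gt0.
- exact: mix.
- have -> : (1 - c) / 2 * Mk = e * (Mk / (1 - c)).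
    by rewrite /e; field; rewrite gt_eqF.
  apply: defect; [exact: coef1|exact: coefK| | |].
  + by rewrite divr_ge0 ?M_ge0 ?(ltW c'0).
  + by rewrite ltr_pdivrMr//; exact: MN1.
  + move=> j; apply: le_trans (dist_le _) _.
    rewrite ler_pM2r ?invr_gt0//; apply: le_max_residual; first exact: leq_addr.
    by have := mk_le m kappa k; have := ltn_ord j; lia.
- by apply: le_trans (gN2 _ kN2); lra.
Qed.
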